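(* Let $r$ be a relation, $f$ an aggregate function and $MinSeuil>0$ a threshold such that the constraint ''$f\geq MinSeuil$'' on $CL(r)$ is antimonotone. Then the iceberg cube of $r$ is a convex cube, characterized by $$CubeIceberg(r) = \{t\in CL(r)\mid t[f]\geq MinSeuil\}.$$
   Context: A relation $r$ is a finite nonempty collection of tuples over a finite nonempty set $\mathcal{D}$ of dimension attributes and a set of measure attributes. For $A\in\mathcal{D}$, $Dim(A)$ is the set of values of $A$ occurring in $r$; $\mathrm{ALL}$ is a new symbol not in any $Dim(A)$. The multidimensional space is $$Space(r) = \Big(\prod_{A\in\mathcal{D}} (Dim(A)\cup\{\mathrm{ALL}\})\Big)\cup\{(\emptyset,\dots,\emptyset)\},$$ where $(\emptyset,\dots,\emptyset)$ is an additional element. The generalization order on $Space(r)$ is: $u\preceq_g v$ iff either $v=(\emptyset,\dots,\emptyset)$, or $u,v\neq(\emptyset,\dots,\emptyset)$ and $u[A]=v[A]$ for all $A\in\mathcal{D}$ with $u[A]\neq\mathrm{ALL}$. The cube lattice is $CL(r)=\langle Space(r),\preceq_g\rangle$. Tuples of $r$, projected on $\mathcal{D}$, are regarded as elements of $CL(r)$. $Datacube(r)$ is the set of $t\in CL(r)$ for which there is $t'\in r$ with $t\preceq_g t'$. For an aggregate function $f$ (on the measures, or counting tuples), $t[f]\in\mathbb{R}$ denotes the value of $f$ applied to the collection of tuples $t'$ of $r$ with $t\preceq_g t'$; by convention $t[f]=0$ if there is no such $t'$. The iceberg cube $CubeIceberg(r)$ (the query GROUP BY CUBE $\mathcal{D}$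 HAVING $f\geq MinSeuil$) is the set of tuples $t$ of $Datacube(r)$ with $t[f]\geq MinSeuil$. A constraint (predicate) $Const$ on $CL(r)$ is monotone if $t\preceq_g u$ and $Const(t)$ imply $Const(u)$, and antimonotone if $t\preceq_g u$ and $Const(u)$ imply $Const(t)$. A convex cube is a set of the form $\{t\in CL(r)\mid const(t)\}$, where $const$ is a conjunction of monotone and/or antimonotone constraints; such a set $\mathcal{C}$ is order-convex: $x\preceq_g y\preceq_g z$ and $x,z\in\mathcal{C}$ imply $y\in\mathcal{C}$. *)

(* Defs.v *)
From HB Require Import structures.
From mathcomp Require Import all_boot all_order all_algebra.
From mathcomp Require Import finmap multiset reals.

Set Implicit Arguments.
Unset Strict Implicit.
Unset Printing Implicit Defensive.

Local Open Scope fset_scope.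
Local Open Scope mset_scope.
Local Open Scope order_scope.

(* A tuple assigns a value to each dimension attribute [A : D] and to each
   measure attribute [m : M]; attributes have their own value types. *)
Definition dbtuple (D : finType) (V : D -> choiceType)
    (M : finType) (W : M -> choiceType) : choiceType :=
  ({dffun forall A : D, V A} * {dffun forall m : M, W m})%type.

Section CubeLattice.
Context {D : finType} {V : D -> choiceType} {M : finType} {W : M -> choiceType}.
Implicit Type r : {mset dbtuple V W}.

Definition Dim r (A : D) : {fset V A} := [fset t.1 A | t : dbtuple V W in r].

(* The outer [None] is the additional element (emptyset, ..., emptyset); in a
   coordinate, [None] is ALL and [Some a] is the value [val a]. *)
Definition CubeSpace r : Type := option {dffun forall A : D, option (Dim r A)}.

HB.instance Definition _ r := Finite.copy (CubeSpace r)
  (option {dffun forall A : D, option (Dim r A)}).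

Definition le_g r (u v : CubeSpace r) : bool :=
  match u, v with
  | _, None => true
  | None, Some _ => false
  | Some u, Some v => [forall A, (u A != None) ==> (u A == v A)]
  end.

Fact le_g_refl r : reflexive (@le_g r).
Proof. by case=> //= u; apply/forallP=> A; apply/implyP. Qed.

Fact le_g_anti r : antisymmetric (@le_g r).
Proof.
move=> [u|] [v|] //= /andP[/forallP uv /forallP vu]; congr Some.
apply/ffunP=> A; case: (eqVneq (u A) None) => [uA|uA]; last first.
  by apply/eqP; apply: (implyP (uv A)).
case: (eqVneq (v A) None) => [->//|vA].
by apply/esym/eqP; apply: (implyP (vu A)).
Qed.

Fact le_g_trans r : transitive (@le_g r).
Proof.
move=> [v|] [u|] [w|] //= /forallP uv /forallP vw.
apply/forallP=> A; apply/implyP=> uA.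
have /eqP uvA := implyP (uv A) uA.
by rewrite uvA; apply: (implyP (vw A)); rewrite -uvA.
Qed.

Fact cube_display : Order.disp_t. Proof. exact: Order.Disp tt tt. Qed.

(* With this order, [CubeSpace r] is the cube lattice CL(r). *)
HB.instance Definition _ r :=
  Order.Le_isPOrder.Build cube_display (CubeSpace r)
    (@le_g_refl r) (@le_g_anti r) (@le_g_trans r).

(* The projection on the dimensions of a tuple, as an element of [CubeSpace r]. It is
   meaningful for the tuples of [r] only, where [insub] succeeds ([cellE]). *)
Definition cell r (t : dbtuple V W) : CubeSpace r :=
  Some [ffun A : D => insub (t.1 A) : option (Dim r A)].

Lemma cellE r (t : dbtuple V W) : t \in r ->
  exists2 c, cell r t = Some c & forall A, omap val (c A) = Some (t.1 A).
Proof.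
move=> tr; eexists; first by [].
move=> A; rewrite ffunE; case: insubP => [a _ /= ->//|/negP[]].
by apply/imfsetP; exists t.
Qed.

Definition Datacube r : {set CubeSpace r} :=
  [set t : CubeSpace r | has (fun t' => t <= cell r t') r].

Definition covered r (t : CubeSpace r) : {mset dbtuple V W} :=
  seq_mset [seq t' <- r | t <= cell r t'].

(* The value t[f] *)
Definition agg {R : realType} r (f : {mset dbtuple V W} -> R) (t : CubeSpace r) : R :=
  if covered t == mset0 then 0%R else f (covered t).

Definition CubeIceberg {R : realType} r (f : {mset dbtuple V W} -> R) (MinSeuil : R) :
    {set CubeSpace r} :=
  [set t in Datacube r | MinSeuil <= agg f t].

End CubeLattice.

Section Constraints.
Context {d : Order.disp_t} {T : finPOrderType d}.
Implicit Type c : pred T.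

Definition monotone_constraint c : Prop := forall t u : T, t <= u -> c t -> c u.

Definition antimonotone_constraint c : Prop := forall t u : T, t <= u -> c u -> c t.

Definition convex_cube (C : {set T}) : Prop :=
  exists (n : nat) (c : 'I_n -> pred T),
    (forall i, monotone_constraint (c i) \/ antimonotone_constraint (c i)) /\
    C = [set t | [forall i, c i t]].

End Constraints.

(* Main.v *)
Require Import Defs.
From mathcomp Require Import all_boot all_order all_algebra.
From mathcomp Require Import finmap multiset reals.

Local Open Scope mset_scope.
Local Open Scope ring_scope.

Import Order.TTheory.

(** The two sets could differ only outside [Datacube r], where [agg] is 0 and the positive threshold
    rejects [t]. The iceberg cube is thus cut out by a single antimonotone constraint, hence
    convex. *)

(* Outside the data cube the convention [t[f] = 0] applies, and [0 < MinSeuil]: so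
   [f >= MinSeuil] already forces [t] into the data cube. *)
Lemma agg_notin_Datacube (D : finType) (V : D -> choiceType) (M : finType)
    (W : M -> choiceType) (r : {mset dbtuple V W}) (R : realType)
    (f : {mset dbtuple V W} -> R) (t : CubeSpace r) :
  t \notin Datacube r -> agg f t = 0.
Proof.
rewrite inE has_filter negbK /agg /covered => /eqP ->.
(* No tuple is covered, so the only branch left claims that [seq_mset [::]] differs from [mset0];
   multiplicities refute it. *)
case: eqP => // [[]]; apply/msetP => x.
by rewrite mset_seqE mset0E.
Qed.

Theorem proposition4p2
  (D : finType) (V : D -> choiceType) (M : finType) (W : M -> choiceType)
  (hD : (0 < #|D|)%N)
  (r : {mset dbtuple V W}) (hr : r != mset0)
  (R : realType) (f : {mset dbtuple V W} -> R)
  (MinSeuil : R) (hMin : 0 < MinSeuil)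
  (hanti : antimonotone_constraint (fun t : CubeSpace r => MinSeuil <= agg f t)) :
  convex_cube (CubeIceberg r f MinSeuil) /\
  CubeIceberg r f MinSeuil = [set t : CubeSpace r | MinSeuil <= agg f t].
Proof.
have icebergE : CubeIceberg r f MinSeuil = [set t : CubeSpace r | MinSeuil <= agg f t].
  apply/setP => t; rewrite in_set [RHS]in_set.
  have [//|/agg_notin_Datacube ->] := boolP (t \in Datacube r).
  by rewrite leNgt hMin.
(* The conjunction has one member, the threshold constraint, antimonotone by [hanti]. *)
split=> //; exists 1%N, (fun=> [pred t | MinSeuil <= agg f t]); split=> [i|].
  by right.
rewrite icebergE; apply/setP => t; rewrite !in_set.
by apply/idP/forallP => [//|/(_ ord0)].
Qed.
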